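(* Let $H$ be a monoid such that $H_{\mathrm{red}}$ is finitely generated. Then $\delta(H)<\infty$ and $\mathsf c_{\mathrm{mon}}(H)<\infty$.
   Context: A monoid is a commutative semigroup $H$ with identity which is unit-cancellative: $a=au$ with $a,u\in H$ implies $u\in H^\times$ (the group of invertible elements); it need not be cancellative. $H_{\mathrm{red}}=\{aH^\times\mid a\in H\}$. An element $u\in H\setminus H^\times$ is an atom if $u=ab$ implies $a\in H^\times$ or $b\in H^\times$; $H$ is atomic if every non-unit is a finite product of atoms (which holds if $H_{\mathrm{red}}$ is finitely generated). For atomic $H$: $\mathsf Z(H)$ is the free abelian monoid on the atoms of $H_{\mathrm{red}}$, $|z|$ is the length (number of factors with multiplicity) of $z\in\mathsf Z(H)$, $\pi:\mathsf Z(H)\to H_{\mathrm{red}}$ is the canonical homomorphism, $\mathsf Z(a)=\pi^{-1}(aH^\times)$, $\mathsf L(a)=\{|z|\mid z\in\mathsf Z(a)\}$ (similarly for elements of $H_{\mathrm{red}}$). $\mathsf d(z,z')=\max\{|zg^{-1}|,|z'g^{-1}|\}$ with $g=\gcd(z,z')$. Distinct $k,\ell\in L\subset\mathbb Z$ are adjacent in $L$ if no other element of $L$ lies between them. For $z\in\mathsf Z(H)$, $\delta(z)$ is the smallest $N\in\mathbb N_0$ such that whenever $k\in\mathbb N$ and $|z|$ are adjacent in $\mathsf L(\pi(z))$, there is $y\in\mathsf Z(H)$ with $\pi(y)=\pi(z)$, $|y|=k$, $\mathsf d(z,y)\le N$. The (strong) successive distance is $\delta(H)=\sup\{\delta(z)\mid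 z\in\mathsf Z(H)\}\in\mathbb N_0\cup\{\infty\}$. The monotone catenary degree $\mathsf c_{\mathrm{mon}}(H)$ is the smallest $N\in\mathbb N_0\cup\{\infty\}$ such that for all $a\in H$ and $z,z'\in\mathsf Z(a)$ there are $z=z_0,\dots,z_k=z'$ in $\mathsf Z(a)$ with $\mathsf d(z_{i-1},z_i)\le N$ for all $i$ and $|z_0|\le\dots\le|z_k|$ or $|z_0|\ge\dots\ge|z_k|$. *)

(* Defs.v *)
From HB Require Import structures.
From mathcomp Require Import all_boot all_order finmap.
From mathcomp Require Import multiset boolp classical_sets.

Set Implicit Arguments.
Unset Strict Implicit.
Unset Printing Implicit Defensive.

Import Order.TTheory.

Local Open Scope classical_set_scope.
Local Open Scope quotient_scope.

(* The set H^* of invertible elements. *)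
Definition units (M : monoidType) : set M :=
  [set u | exists2 v, u * v = 1 & v * u = 1]%g.

(* Commutative unit-cancellative monoids; cancellativity is not assumed. *)
HB.mixin Record Monoid_isUnitCancellative (H : Type) of Monoid H := {
  ucmulC : commutative (@mul H);
  unit_cancel : forall a u : H, a = (a * u)%g -> units u
}.

#[short(type="ucMonoidType")]
HB.structure Definition UCMonoid :=
  {H of Monoid H & Monoid_isUnitCancellative H}.

Section Reduced.
Variable H : ucMonoidType.
Implicit Types a b u : H.

Lemma units1 : units (1%g : H).
Proof. by exists 1%g; rewrite mulg1. Qed.

Lemma unitsM u v : units u -> units v -> units (u * v)%g.
Proof.
move=> [u' uu' u'u] [v' vv' v'v]; exists (v' * u')%g.
  by rewrite mulgA -(mulgA u) vv' mulg1.
by rewrite mulgA -(mulgA v') u'u mulg1.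
Qed.

Lemma unitsMl u v : units (u * v)%g -> units u.
Proof.
by move=> [w uvw _]; exists (v * w)%g; last rewrite ucmulC; rewrite mulgA.
Qed.

Definition unit_coset a : set H := [set (a * u)%g | u in @units H].

Lemma unit_cosetP a b :
  unit_coset a = unit_coset b <-> exists2 u, units u & b = (a * u)%g.
Proof.
split=> [eab|[u [v uv vu] ->]].
  have : unit_coset b b by exists 1%g; [exact: units1|rewrite mulg1].
  by rewrite -eab => -[u Uu <-]; exists u.
have Uu : units u by exists v.
have Uv : units v by exists u.
apply/seteqP; split=> x [w Uw <-].
  by exists (v * w)%g; [exact: unitsM|rewrite mulgA -(mulgA a) uv mulg1].
by exists (u * w)%g; [exact: unitsM|rewrite mulgA].
Qed.

Definition associated : rel H := fun a b => `[< unit_coset a = unit_coset b >].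

Lemma associated_equiv : equiv_class_of associated.
Proof.
split=> [a|a b|b a c]; first exact/asboolP.
  by apply/asboolP/asboolP => ->.
by move=> /asboolP eab /asboolP ebc; apply/asboolP; rewrite eab.
Qed.

Canonical associated_equiv_rel := EquivRelPack associated_equiv.

(* H_red; the class \pi_(red H) a is the coset a H^*. *)
Definition red := {eq_quot associated}.
HB.instance Definition _ := Choice.on red.
HB.instance Definition _ := EqQuotient.on red.

Lemma red_eqP a b : \pi_red a = \pi_red b <-> unit_coset a = unit_coset b.
Proof.
split=> [/eqP|e]; first by rewrite eqmodE => /asboolP.
by apply/eqP; rewrite eqmodE; apply/asboolP.
Qed.

Definition red_one : red := \pi_red 1%g.
Definition red_mul (x y : red) : red := \pi_red (repr x * repr y)%g.

Lemma red_mulE a b : red_mul (\pi_red a) (\pi_red b) = \pi_red (a * b)%g.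
Proof.
have reprE c : exists2 u, units u & repr (\pi_red c) = (c * u)%g.
  by apply/unit_cosetP/red_eqP; rewrite reprK.
rewrite /red_mul; have [u Uu ->] := reprE a; have [v Uv ->] := reprE b.
apply/esym/red_eqP/unit_cosetP; exists (u * v)%g; first exact: unitsM.
by rewrite -!mulgA; congr (_ * _)%g; rewrite !mulgA (ucmulC u).
Qed.

Lemma red_surj (x : red) : exists a, x = \pi_red a.
Proof. by exists (repr x); rewrite reprK. Qed.

Lemma red_mulA : associative red_mul.
Proof.
move=> x y z; have [a ->] := red_surj x; have [b ->] := red_surj y.
by have [c ->] := red_surj z; rewrite !red_mulE mulgA.
Qed.

Lemma red_mul1 : left_id red_one red_mul.
Proof. by move=> x; have [a ->] := red_surj x; rewrite red_mulE mul1g. Qed.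

Lemma red_mulC : commutative red_mul.
Proof.
move=> x y; have [a ->] := red_surj x; have [b ->] := red_surj y.
by rewrite !red_mulE ucmulC.
Qed.

Lemma red_1mul : right_id red_one red_mul.
Proof. by move=> x; rewrite red_mulC red_mul1. Qed.

HB.instance Definition _ := isMonoid.Build red red_mulA red_mul1 red_1mul.

Lemma pi_redM a b : (\pi_red a * \pi_red b)%g = \pi_red (a * b)%g.
Proof. exact: red_mulE. Qed.

Lemma red_unit_cancel (x y : red) : x = (x * y)%g -> units y.
Proof.
have [a ->] := red_surj x; have [u ->] := red_surj y; rewrite pi_redM.
move=> /esym /red_eqP /unit_cosetP [v Uv]; rewrite -mulgA.
move=> /unit_cancel /unitsMl [w uw wu].
by exists (\pi_red w); rewrite pi_redM ?uw ?wu.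
Qed.

HB.instance Definition _ :=
  Monoid_isUnitCancellative.Build red red_mulC red_unit_cancel.

End Reduced.

Definition finitely_generated (M : monoidType) : Prop :=
  exists s : seq M, forall x : M,
    exists2 t : seq M, {subset t <= s} & x = (\prod_(y <- t) y)%g.

Definition atom (M : monoidType) (u : M) : Prop :=
  ~ units u /\ forall a b : M, u = (a * b)%g -> units a \/ units b.

(* N_0 together with infinity. *)
Variant enat := Fin of nat | Inf.

Definition enat_option (x : enat) : option nat :=
  if x is Fin n then Some n else None.
Definition option_enat (x : option nat) : enat :=
  if x is Some n then Fin n else Inf.
Lemma enat_optionK : cancel enat_option option_enat. Proof. by case. Qed.
HB.instance Definition _ := Choice.copy enat (can_type enat_optionK).

Definition le_enat (x y : enat) : bool :=
  match x, y with
  | _, Inf => true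
  | Inf, Fin _ => false
  | Fin m, Fin n => (m <= n)%N
  end.
Definition lt_enat (x y : enat) : bool := (y != x) && le_enat x y.

Lemma le_enat_refl : reflexive le_enat.
Proof. by case=> //= n; exact: leqnn. Qed.
Lemma le_enat_anti : antisymmetric le_enat.
Proof. by case=> [m|] [n|] //= /anti_leq ->. Qed.
Lemma le_enat_trans : transitive le_enat.
Proof. by case=> [m|] [n|] [p|] //=; exact: leq_trans. Qed.
Lemma le_enat_total : total le_enat.
Proof. by case=> [m|] [n|] //=; exact: leq_total. Qed.

Fact enat_display : Order.disp_t. Proof. exact: Order.Disp tt tt. Qed.

HB.instance Definition _ := Order.isPOrder.Build enat_display enat
  (fun _ _ => erefl) le_enat_refl le_enat_anti le_enat_trans.
HB.instance Definition _ :=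
  Order.POrder_isTotal.Build enat_display enat le_enat_total.
Lemma le_enat_Inf (x : enat) : (x <= Inf)%O. Proof. by case: x. Qed.
HB.instance Definition _ := Order.hasTop.Build enat_display enat le_enat_Inf.

(* The smallest element of A; x0 is returned when there is none. *)
Definition least_elt d (T : porderType d) (x0 : T) (A : set T) : T :=
  xget x0 (A `&` lbound A).

Definition adjacent (L : set nat) (k l : nat) : Prop :=
  [/\ L k, L l, k <> l &
      forall m, L m -> ~ (k < m < l)%N /\ ~ (l < m < k)%N].

Definition red_atom (H : ucMonoidType) := {u : red H | `[< atom u >]}.

(* Z(H), the free abelian monoid on the atoms of H_red, as finite multisets. *)
Notation factorization H := {mset (red_atom H)}%mset.

Section Factorizations.
Variable H : ucMonoidType.
Implicit Types (z y : factorization H) (x : red H) (a : H).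

Definition flength z : nat := size z.

Definition factprod z : red H := (\prod_(u <- z) val u)%g.

Definition Zset x : set (factorization H) := [set z | factprod z = x].
Definition Lset x : set nat := [set flength z | z in Zset x].

Definition fdist z y : nat :=
  let g := (z `&` y)%mset in
  maxn (flength (z `\` g)%mset) (flength (y `\` g)%mset).

Definition delta_bound z : set nat :=
  [set N | forall k, (0 < k)%N -> adjacent (Lset (factprod z)) k (flength z) ->
     exists y, [/\ factprod y = factprod z, flength y = k & (fdist z y <= N)%N]].

Definition delta z : nat := least_elt 0%N (delta_bound z).

Definition successive_distance : enat :=
  supremum (Fin 0) [set Fin (delta z) | z in [set: factorization H]].

Definition monotone_chain (a : H) (N : enat) z z' : Prop :=
  exists s : seq (factorization H),
    [/\ [set` z :: s] `<=` Zset (\pi_(red H) a),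
        last z s = z',
        path (fun y y' => Fin (fdist y y') <= N)%O z s &
        sorted leq (map flength (z :: s)) \/ sorted geq (map flength (z :: s))].

Definition monotone_bound : set enat :=
  [set N | forall a z z', Zset (\pi_(red H) a) z -> Zset (\pi_(red H) a) z' ->
     monotone_chain a N z z'].

Definition monotone_catenary_degree : enat := least_elt Inf monotone_bound.

End Factorizations.

Lemma nat_least (A : set nat) : A !=set0 -> (A `&` lbound A) !=set0.
Proof.
move=> [n An].
have exA : exists n, `[< A n >] by exists n; apply/asboolP.
case: (ex_minnP exA) => m /asboolP Am mmin; exists m; split=> // k Ak.
by rewrite leEnat; apply: mmin; apply/asboolP.
Qed.

Lemma enat_least (A : set enat) : A !=set0 -> (A `&` lbound A) !=set0.
Proof.
move=> [x Ax]; have [fA|nfA] := pselect (exists n, A (Fin n)).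
  have [m [Am mmin]] := @nat_least [set n | A (Fin n)] fA.
  by exists (Fin m); split=> // -[k|] // /mmin.
exists Inf; split; last by case=> // n An; case: nfA; exists n.
by case: x Ax => // n An; case: nfA; exists n.
Qed.

Lemma least_eltP d (T : porderType d) (x0 : T) (A : set T) :
  (A `&` lbound A) !=set0 -> A (least_elt x0 A) /\ lbound A (least_elt x0 A).
Proof. by move=> ex; have := @xgetPex _ x0 _ ex. Qed.

Section Checks.
Variable H : ucMonoidType.
Implicit Types z : factorization H.

Lemma adjacent_uniq (L : set nat) k k' l :
  adjacent L k l -> adjacent L k' l -> (k < l)%N = (k' < l)%N -> k = k'.
Proof.
move=> [Lk Ll nkl Hk] [Lk' _ nkl' Hk'].
have [A B] := Hk _ Lk'; have [C D] := Hk' _ Lk.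
move/eqP: nkl; move/eqP: nkl'.
by case: (ltngtP k l) A B C D => //; case: (ltngtP k' l) => //;
  case: (ltngtP k k') => // *; exfalso; auto.
Qed.

Lemma delta_bound_neq0 z : delta_bound z !=set0.
Proof.
pose L := Lset (factprod z).
have side b : exists N, forall k, adjacent L k (flength z) ->
    (k < flength z)%N = b ->
    exists y, [/\ factprod y = factprod z, flength y = k & (fdist z y <= N)%N].
  have [[k [adk kb]]|nk] := pselect
      (exists k, adjacent L k (flength z) /\ (k < flength z)%N = b).
    have [[y yz yk] _ _ _] := adk; exists (fdist z y) => k' adk' k'b.
    exists y; split=> //; rewrite yk.
    by apply: (adjacent_uniq adk adk'); rewrite kb.
  by exists 0%N => k adk kb; case: nk; exists k.
have [N HN] := side true; have [N' HN'] := side false.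
exists (maxn N N') => k _ adk; case kb : (k < flength z)%N.
  have [y [? ? le]] := HN _ adk kb.
  by exists y; split=> //; rewrite leq_max le.
have [y [? ? le]] := HN' _ adk kb.
by exists y; split=> //; rewrite leq_max le orbT.
Qed.

Lemma delta_least z :
  delta_bound z (delta z) /\ forall N, delta_bound z N -> (delta z <= N)%N.
Proof. exact/least_eltP/nat_least/delta_bound_neq0. Qed.

Lemma successive_distance_finite :
  (successive_distance H < \top)%O <-> exists N, forall z, (delta z <= N)%N.
Proof.
pose S := [set Fin (delta z) | z in [set: factorization H]].
have S0 : S != set0.
  by apply/set0P; pose z0 : factorization H := mset0; exists (Fin (delta z0)), z0.
have [ubS lubS] : supremums S (supremum (Fin 0) S).
  rewrite /supremum (negPf S0); apply: xgetPex.
  by apply: (@enat_least (ubound S)); exists Inf => x _; exact: le_enat_Inf.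
rewrite /successive_distance -/S; split=> [|[N HN]].
  case E: (supremum _ S) ubS => [n|] // ubS _.
  by exists n => z; apply: (ubS (Fin (delta z))); exists z.
have : (supremum (Fin 0) S <= Fin N)%O by apply: lubS => x [z _ <-]; exact: HN.
by move/le_lt_trans; apply.
Qed.

Lemma monotone_bound_Inf : monotone_bound H Inf.
Proof.
move=> a z z' az az'; exists [:: z']; split=> //=.
- by move=> y /=; rewrite !inE => /orP[]/eqP->.
- by rewrite !andbT; apply/orP; exact: leq_total.
Qed.

Lemma monotone_catenary_degree_least :
  monotone_bound H (monotone_catenary_degree H) /\
  forall N, monotone_bound H N -> (monotone_catenary_degree H <= N)%O.
Proof.
apply/least_eltP/enat_least; exists Inf; exact: monotone_bound_Inf.
Qed.

End Checks.

(* Main.v *)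
(* All finiteness comes from Dickson's lemma on N^n.  If a relation R on Z(H) is
   invariant under translation, Dickson's lemma applied to the pairs (x, y) with
   R x y, ordered by the multiplicities of x and by the difference of the
   lengths of x and y, yields finitely many pairs of which every other pair
   dominates a translate; so y may be chosen at bounded distance from x without
   enlarging that difference.  With R := "same product and |x| < |y|" (or
   |y| < |x|) this bounds delta(H).  With R := "same product and length, and y
   lexicographically below x" every factorization descends in bounded steps to
   the least one of its product and length, so any two factorizations of equal
   product and length are joined by bounded steps.  A monotone chain first
   climbs to the right length and then stays at that length. *)
Require Import Defs.
From HB Require Import structures.
From mathcomp Require Import all_boot all_order finmap.
From mathcomp Require Import multiset boolp classical_sets zify.

Set Implicit Arguments.
Unset Strict Implicit.
Unset Printing Implicit Defensive.

Local Open Scope mset_scope.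

HB.instance Definition _ (M : ucMonoidType) :=
  SemiGroup.isCommutativeLaw.Build M (@mul M) (@ucmulC M).

(** * Sums of multisets *)

Section Multisets.
Variable K : choiceType.
Implicit Types x y w : {mset K}.

Lemma perm_msetD x y : perm_eq (x `+` y) (x ++ y).
Proof.
by apply/allP => a _ /=; rewrite count_cat !count_mem_mset msetE2.
Qed.

Lemma size_msetD x y : size (x `+` y) = size x + size y.
Proof. by rewrite (perm_size (perm_msetD x y)) size_cat. Qed.

End Multisets.

(** * Dickson's lemma *)

Section Dickson.
Variables (K : eqType) (T : Type) (f : K -> T -> nat).

(* The finite basis of A appears as the set of its elements with g b <= N. *)
Lemma dickson (s : seq K) (A : set T) (g : T -> nat) :
  exists N, forall a, A a ->
    exists b, [/\ A b, g b <= N & {in s, forall u, f u b <= f u a}].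
Proof.
elim: s A g => [|u s IHs] A g.
  have [[b Ab]|A0] := pselect (exists b, A b); last first.
    by exists 0 => a Aa; case: A0; exists a.
  by exists (g b) => a _; exists b.
(* Bounding [g + f u] yields a [b] with [f u b <= N], which serves every [a] with [N <= f u a]. The
   finitely many smaller values [m] of [f u a] are handled slice by slice, with bounds [M m]. *)
have [N HN] := IHs A (fun a => g a + f u a).
have /choice[M HM] m := IHs (fun a => A a /\ f u a = m) g.
exists (N + \sum_(m < N) M m) => a Aa.
have [ltaN|leNa] := ltnP (f u a) N.
  have [b [[Ab fb] gb leba]] := HM (f u a) a (conj Aa erefl).
  exists b; split=> // [|v].
    by rewrite (bigD1 (Ordinal ltaN)) //=; lia.
  by rewrite inE => /orP[/eqP->|/leba//]; rewrite fb.
have [b [Ab gb leba]] := HN a Aa.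
exists b; split=> // [|v]; first by lia.
by rewrite inE => /orP[/eqP->|/leba//]; lia.
Qed.

End Dickson.

(** * Chains of related elements *)

Section Linked.
Variable T : Type.
Implicit Types (e : rel T) (x y z : T).

Definition linked e x y := exists2 s, path e x s & last x s = y.

Lemma linked_trans e y x z : linked e x y -> linked e y z -> linked e x z.
Proof.
move=> [s es <-] [t et <-]; exists (s ++ t); last by rewrite last_cat.
by rewrite cat_path es.
Qed.

Lemma linked_step e y x z : e x y -> linked e y z -> linked e x z.
Proof. by move=> exy; apply: linked_trans; exists [:: y] => //=; rewrite exy. Qed.

Lemma sub_linked e e' x y : subrel e e' -> linked e x y -> linked e' x y.
Proof. by move=> ee' [s /(sub_path ee') es sy]; exists s. Qed.

Lemma linked_rev e x y : linked e x y -> linked (fun a b => e b a) y x.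
Proof.
move=> [s es <-]; exists (rev (belast x s)); first by rewrite rev_path.
by case: s {es} => //= a s; rewrite rev_cons last_rcons.
Qed.

End Linked.

(** * Lexicographic comparison of multisets *)

Section Lexicographic.
Variable K : choiceType.
Implicit Types (e : seq K) (x y w : {mset K}).

Fixpoint mlex e x y : bool :=
  if e is u :: e' then (x u < y u) || (x u == y u) && mlex e' x y else false.

Lemma mlexD e w x y : mlex e (x `+` w) (y `+` w) = mlex e x y.
Proof. by elim: e => //= u e ->; rewrite !msetE2 ltn_add2r eqn_add2r. Qed.

Lemma mlex_total e x y :
  (forall u, u \in e) -> x <> y -> mlex e x y \/ mlex e y x.
Proof.
move=> efull nxy.
suff [exy|//]: {in e, x =1 y} \/ (mlex e x y \/ mlex e y x).
  by case: nxy; apply/msetP => u; exact: exy.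
elim: e {efull} => [|u e IHe] /=; first by left.
case: (ltngtP (x u) (y u)) => [||xyu] /=; [by right; left|by right; right|].
case: IHe => [exy|]; last by right.
by left=> v; rewrite inE => /orP[/eqP->|/exy].
Qed.

(** Minimise the first multiplicity, then recurse among its minimisers. *)
Lemma mlex_min e (A : set {mset K}) :
  (exists x, A x) -> exists x, A x /\ forall y, A y -> ~~ mlex e y x.
Proof.
elim: e A => [|u e IHe] A [x0 Ax0]; first by exists x0.
have [_ [[x1 Ax1 <-] x1min]] :
    exists n, [set x u | x in A]%classic n /\
              lbound [set x u | x in A]%classic n.
  by apply: nat_least; exists (x0 u), x0.
have [|x [[Ax xu] xmin]] := IHe (fun x => A x /\ x u = x1 u); first by exists x1.
exists x; split=> // y Ay /=; rewrite xu negb_or -leqNgt.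
apply/andP; split; first by apply: x1min; exists y.
by apply/nandP; case: eqP => [yu|_]; [right; exact: xmin|left].
Qed.

End Lexicographic.

(** * Bounded steps between factorizations *)

Section Translation.
Variables (H : ucMonoidType) (e : seq (red_atom H)).
Hypothesis e_full : forall u, u \in e.
Implicit Types (x y w : factorization H) (N : nat).

Definition translation_invariant (R : factorization H -> factorization H -> Prop) :=
  forall w x y, R x y -> R (x `+` w) (y `+` w).

Lemma factprodD x y : factprod (x `+` y) = (factprod x * factprod y)%g.
Proof. by rewrite /factprod (perm_big _ (perm_msetD x y)) big_cat. Qed.

Lemma flengthD x y : flength (x `+` y) = flength x + flength y.
Proof. exact: size_msetD. Qed.

Lemma fdistD w x y : fdist (x `+` w) (y `+` w) = fdist x y.
Proof. by rewrite /fdist -msetDIl !msetBDr. Qed.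

Lemma fdistC x y : fdist x y = fdist y x.
Proof. by rewrite /fdist maxnC msetIC. Qed.

(** The absolute difference of the lengths, as truncation makes one summand zero. *)
Definition length_gap x y := (flength x - flength y) + (flength y - flength x).

Lemma bounded_witness (R : factorization H -> factorization H -> Prop) :
  translation_invariant R ->
  exists N, forall x y, R x y ->
    exists y', [/\ R x y', fdist x y' <= N & length_gap x y' <= length_gap x y].
Proof.
move=> Rinv.
(* [None] selects the length gap. Multiplicities are compared for the first component only, because
   one and the same [w] translates both. *)
pose f (o : option (red_atom H)) (p : factorization H * factorization H) :=
  if o is Some u then p.1 u else length_gap p.1 p.2.
have [N HN] := dickson f (None :: map Some e) (fun p => R p.1 p.2)
                 (fun p => fdist p.1 p.2).
exists N => x y /(HN (x, y))[[x' y'] /= [Rxy' dN le_f]].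
have [w xE] : exists w, x = x' `+` w.
  exists (x `\` x'); apply/esym/msetBDKC/msubsetP => u.
  by apply: (le_f (Some u)); rewrite inE map_f.
subst x; exists (y' `+` w); rewrite fdistD; split=> //; first exact: Rinv.
apply: leq_trans (le_f None _); last by rewrite inE.
by rewrite /= /length_gap !flengthD !subnDr.
Qed.

(** A metric form of Rédei's theorem that congruences on N^n are finitely generated. *)
Lemma redei (R : rel (factorization H)) :
  equivalence_rel R -> translation_invariant R ->
  exists N, forall x y, R x y ->
    linked (fun a b => R a b && (fdist a b <= N)) x y.
Proof.
move=> /equivalence_relP[Rxx Rtr] Rinv.
have Rsym x y : R x y = R y x.
  by apply/idP/idP => /Rtr <-; exact: Rxx.
have [|N HN] := @bounded_witness (fun x y => R x y /\ mlex e y x).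
  by move=> w x y [/Rinv Rw lexyx]; rewrite mlexD.
exists N => z z' Rzz'; set r := (X in linked X).
have rsym a b : r b a = r a b by rewrite /r Rsym fdistC.
have [|m [Rzm m_min]] := @mlex_min _ e (fun x => R z x); first by exists z.
have to_m x : R z x -> linked r x m.
  move=> Rzx; apply: contrapT => nxm.
  (* Least counterexample [b]: a bounded step from [b] leads lexicographically lower, hence to an
     element linked to [m], so [b] is linked to [m] too. *)
  have [|b [[Rzb nbm] b_min]] :=
    @mlex_min _ e (fun x => R z x /\ ~ linked r x m); first by exists x.
  have [ebm|nebm] := eqVneq b m; first by case: nbm; exists [::].
  have lemb : mlex e m b.
    case: (mlex_total e_full (elimN eqP nebm)) => // lebm.
    by have := m_min _ Rzb; rewrite lebm.
  have Rbm : R b m by rewrite -(Rtr _ _ Rzb).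
  have [y [[Rby leyb] dby _]] := HN b m (conj Rbm lemb).
  have Rzy : R z y by rewrite (Rtr _ _ Rzb).
  have [lym|nym] := pselect (linked r y m).
    by apply: nbm; apply: (linked_step (y := y)); rewrite ?/r ?Rby.
  by have := b_min y (conj Rzy nym); rewrite leyb.
apply: (linked_trans (y := m)); first exact: to_m.
apply: sub_linked (linked_rev (to_m _ Rzz')) => a b.
by rewrite rsym.
Qed.

(** Requiring a strict inequality of lengths in the relation fixes the direction of the step, and
    the bound on the gap keeps it from overshooting [y]. *)
Lemma bounded_length_step :
  exists N, forall x y, factprod x = factprod y -> flength x <> flength y ->
    exists y', [/\ factprod y' = factprod x, fdist x y' <= N &
      flength x < flength y' <= flength y \/ flength y <= flength y' < flength x].
Proof.
have [|N HN] := @bounded_witness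
    (fun x y => factprod x = factprod y /\ flength x < flength y).
  by move=> w x y [xy lt_xy]; rewrite !factprodD !flengthD ltn_add2r xy.
have [|N' HN'] := @bounded_witness
    (fun x y => factprod x = factprod y /\ flength y < flength x).
  by move=> w x y [xy lt_xy]; rewrite !factprodD !flengthD ltn_add2r xy.
exists (N + N') => x y xy nxy; rewrite /length_gap in HN HN'.
have [lt_xy|lt_yx|//] := ltngtP (flength x) (flength y).
  have [y' [[xy' lt_xy'] dN gap]] := HN x y (conj xy lt_xy).
  by exists y'; split; [by []|lia|left; lia].
have [y' [[xy' lt_xy'] dN gap]] := HN' x y (conj xy lt_yx).
by exists y'; split; [by []|lia|right; lia].
Qed.

Lemma delta_bounded : exists N, forall x, delta x <= N.
Proof.
have [N HN] := bounded_length_step.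
exists N => x; have [_] := delta_least x; apply => k _ [[y xy <-] _ nyx adj].
have [y' [xy' dN y'_between]] := HN x y (esym xy) (fun eq_xy => nyx (esym eq_xy)).
(* Adjacency excludes lengths strictly between, so [y'] has exactly the length of [y]. *)
exists y'; split=> //; have [|] := adj (flength y'); first by exists y'.
by case: y'_between => /andP[]; lia.
Qed.

Lemma monotone_links :
  exists N, forall x y, factprod x = factprod y -> flength x <= flength y ->
    linked [rel a b | [&& factprod a == factprod b, fdist a b <= N &
                          flength a <= flength b]] x y.
Proof.
have [N HN] := bounded_length_step.
pose R : rel (factorization H) :=
  [rel x y | (factprod x == factprod y) && (flength x == flength y)].
have [||N' HN'] := @redei R.
- apply/equivalence_relP; split=> [x|x y /andP[/eqP xy /eqP xy'] z].
    by rewrite /R /= !eqxx.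
  by rewrite /R /= xy xy'.
- by move=> w x y /andP[/eqP xy /eqP xy']; rewrite /R /= !factprodD !flengthD xy xy' !eqxx.
(* [N] bounds the climbing steps, [N'] those at constant length. *)
exists (N + N') => x y; set r := [rel a b | _].
have [n] := ubnP (flength y - flength x); elim: n x => // n IHn x ltn xy le_xy.
have [eq_xy|/eqP neq_xy] := eqVneq (flength x) (flength y).
  have /HN' : R x y by rewrite /R /= xy eq_xy !eqxx.
  apply: sub_linked => a b /andP[/andP[/= -> /eqP->] dN'].
  by rewrite leqnn andbT /=; lia.
have [y' [xy' dN y'_between]] := HN x y xy neq_xy.
have {y'_between} lt_xy' : flength x < flength y' <= flength y.
  by case: y'_between => //; lia.
apply: (linked_step (y := y')); first by rewrite /r /= xy' eqxx; lia.
by apply: IHn; rewrite ?xy' //; lia.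
Qed.

Lemma monotone_catenary_bounded : exists N, monotone_bound H (Fin N).
Proof.
have [N HN] := monotone_links.
(* With [leq] this gives increasing chains; with [geq], decreasing ones, by reversing a chain from
   [y] to [x]. *)
have chainable (r : rel nat) a x y :
    transitive r -> Zset (\pi_(red H) a)%qT x ->
    linked [rel b c | [&& factprod b == factprod c, fdist b c <= N &
                          r (flength b) (flength c)]] x y ->
    exists s, [/\ ([set` x :: s] `<=` Zset (\pi_(red H) a)%qT)%classic,
      last x s = y, path (fun b c => Fin (fdist b c) <= Fin N)%O x s &
      sorted r (map (@flength H) (x :: s))].
  move=> r_tr xa [s xs sy]; exists s; split=> //.
  - rewrite /Zset => b /=; rewrite inE => /orP[/eqP->//|bs].
    have /order_path_min/allP/(_ b bs)/eqP <- // :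
        path [rel b c : factorization H | factprod b == factprod c] x s.
      by apply: sub_path xs => b' c /and3P[].
    by move=> b' c d /= /eqP->.
  - by apply: sub_path xs => b c /and3P[].
  - by rewrite /= path_map; apply: sub_path xs => b c /and3P[].
exists N => a x y xa ya; have xy : factprod x = factprod y by rewrite xa ya.
have [le_xy|/ltnW le_yx] := leqP (flength x) (flength y).
  have [s [? ? ? ?]] := chainable leq a x y leq_trans xa (HN x y xy le_xy).
  by exists s; split=> //; left.
have [|s [? ? ? ?]] := chainable geq a x y (rev_trans leq_trans) xa.
  apply: sub_linked (linked_rev (HN y x (esym xy) le_yx)) => b c /=.
  by rewrite eq_sym fdistC.
by exists s; split=> //; right.
Qed.

End Translation.

(** * Finite generation and atoms *)

Lemma units_red (H : ucMonoidType) (x : red H) : units x -> x = 1%g.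
Proof.
have [a ->] := red_surj x => -[y]; have [b ->] := red_surj y.
rewrite pi_redM => ab1 _; apply/red_eqP/unit_cosetP.
have /red_eqP/esym/unit_cosetP[u [v uv vu] abu] := ab1.
exists (b * v)%g; last by rewrite mulgA abu mul1g uv.
apply: (@unitsMl _ _ a); rewrite -mulgA (ucmulC v) mulgA (ucmulC b) abu mul1g uv.
exact: units1.
Qed.

(** If an atom is a product of generators, all factors but one are units, hence 1 in [red H]; so the
    atom is itself a generator. *)
Lemma atoms_finite (H : ucMonoidType) :
  finitely_generated (red H) -> exists e : seq (red_atom H), forall u, u \in e.
Proof.
move=> [s Hs]; exists (pmap insub s) => u; rewrite mem_pmap_sub.
have [u_nonunit u_atom] := asboolW (valP u).
have [t ts ut] := Hs (val u).
elim: t ts ut => [_ ut|x t IHt ts].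
  by case: u_nonunit; rewrite ut big_nil; exact: units1.
rewrite big_cons => ut; case: (u_atom _ _ ut) => /units_red.
  move=> x1; apply: IHt; first by move=> y yt; apply: ts; rewrite inE yt orbT.
  by rewrite ut x1 mul1g.
by move=> t1; rewrite ut t1 mulg1; apply: ts; rewrite inE eqxx.
Qed.

Theorem theorem3p1 (H : ucMonoidType) (fgH : finitely_generated (red H)) :
  (successive_distance H < \top)%O /\ (monotone_catenary_degree H < \top)%O.
Proof.
have [e e_full] := atoms_finite fgH.
split; first exact/successive_distance_finite/(delta_bounded e_full).
have [N /(monotone_catenary_degree_least H).2] := monotone_catenary_bounded e_full.
by move=> /Order.POrderTheory.le_lt_trans; apply.
Qed.
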